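(* There is a function $R:\mathbb{N}\times\mathbb{N}\to\mathbb{N}$ such that for all $t,k$: if $\mathcal{P}\subset\mathbb{R}^2$ is a point set containing an $R(t,k)$-grid and $\lambda:\mathcal{P}\to[k]$ is any colouring, then $\mathcal{P}$ contains a $t$-grid all of whose points have the same colour $c$, for some $c\in[k]$.
   Context: For $n\in\mathbb{N}$, $[n]=\{1,\dots,n\}$. For a point $p\in\mathbb{R}^2$, $\pi_x(p),\pi_y(p)$ are its coordinates. A $t$-grid is a family of points $(p_{i,j})_{i,j\in[t]}$ such that for all $i,i',j,j'\in[t]$: if $i<i'$ then $\pi_x(p_{i,j})<\pi_x(p_{i',j'})$, and if $j<j'$ then $\pi_y(p_{i,j})<\pi_y(p_{i',j'})$. A point set contains a $t$-grid if some $t$-grid consists of points of the set. *)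

(* Defs.v *)
From mathcomp Require Import all_boot all_order all_algebra.
From mathcomp Require Import boolp classical_sets reals.

Set Implicit Arguments.
Unset Strict Implicit.
Unset Printing Implicit Defensive.

Import Order.TTheory GRing.Theory Num.Theory.

Local Open Scope classical_set_scope.
Local Open Scope ring_scope.

(* The index set [t] = {1, ..., t} is represented by 'I_t = {0, ..., t - 1}. *)
Definition is_grid (R : realType) (t : nat) (p : 'I_t -> 'I_t -> R * R) : Prop :=
  forall i i' j j' : 'I_t,
    ((i < i')%N -> (p i j).1 < (p i' j').1) /\
    ((j < j')%N -> (p i j).2 < (p i' j').2).

Definition contains_grid (R : realType) (t : nat) (P : set (R * R)) : Prop :=
  exists p : 'I_t -> 'I_t -> R * R, is_grid p /\ forall i j, P (p i j).

(* Main.v *)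
Require Import Defs.
From mathcomp Require Import all_boot all_order all_algebra.
From mathcomp Require Import boolp classical_sets reals.

Local Open Scope classical_set_scope.
Local Open Scope ring_scope.

(** Apply the pigeonhole principle twice.  Restrict to [m > k t] columns of the
    big grid; each row then carries a colour vector in [[k]^m], so among more
    than [k^m t] rows, [t] carry the same vector [v]; and [t] of the [m] entries
    of [v] are equal.  Subsets of an index set are enumerated increasingly, so
    the resulting subgrid is a grid. *)

Lemma increasing_enum {n t : nat} (S : {set 'I_n}) :
  (t <= #|S|)%N ->
  exists g : 'I_t -> 'I_n,
    {homo g : i j / (i < j)%N >-> (i < j)%N} /\ forall i, g i \in S.
Proof.
move=> tS; exists (fun i => enum_val (widen_ord tS i)).
split=> [i j ij|i]; last exact: enum_valP.
(* [enum S] filters the enumeration of ['I_n], whose values are [iota 0 n]. *)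
have sorted_S : sorted ltn (map val (enum S)).
  apply: (subseq_sorted ltn_trans _ (iota_ltn_sorted 0 n)).
  by rewrite -val_enum_ord map_subseq // enumT; exact: filter_subseq.
have x0 := enum_val (widen_ord tS i).
rewrite !(enum_val_nth x0) -!(nth_map x0 0%N val) -?cardE ?ltn_ord //.
by apply: (sorted_ltn_nth ltn_trans) => //; rewrite inE size_map -cardE ltn_ord.
Qed.

Lemma increasing_pigeonhole {T : finType} {n t : nat} (f : 'I_n -> T) :
  (#|T| * t < n)%N ->
  exists (y : T) (g : 'I_t -> 'I_n),
    {homo g : i j / (i < j)%N >-> (i < j)%N} /\ forall i, f (g i) = y.
Proof.
move=> Tt_lt_n; suff [y ty] : exists y, (t <= #|[set i | f i == y]%SET|)%N.
  have [g [g_incr gS]] := increasing_enum _ ty; exists y, g; split=> // i.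
  by apply/eqP; have := gS i; rewrite inE.
(* If every fibre had fewer than [t] elements, summing over the fibres would give
   [n <= #|T| * t]. *)
apply/existsP; apply: contraLR Tt_lt_n; rewrite -leqNgt negb_exists => /forallP small.
rewrite -[leqLHS]card_ord -sum1_card (partition_big f predT) //=.
rewrite -sum_nat_const; apply: leq_sum => y _.
rewrite sum1_card -cardsE; apply: ltnW; rewrite ltnNge; exact: small.
Qed.

Theorem theorem6 (R : realType) :
  exists Rtk : nat -> nat -> nat,
    forall (t k : nat) (P : set (R * R)),
      contains_grid (Rtk t k) P ->
      forall lambda : set_type P -> 'I_k,
        exists c : 'I_k,
          contains_grid t [set val q | q in [set q : set_type P | lambda q = c]].
Proof.
(* The big grid is square, so its side must be at least [m], to hold the columns, and exceed
   [k ^ m * t], for the rows; the sum does both since [m > 0]. The successor in [m] also keeps the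
   grid nonempty when [t = 0], so that some colour exists. *)
exists (fun t k => let m := (k * t).+1 in m + k ^ m * t)%N => t k P /=.
set m := (k * t).+1; set n := (m + _)%N => -[p [p_grid pP]] lambda.
have le_mn : (m <= n)%N by exact: leq_addr.
pose q i j : set_type P := exist _ (p i j) (mem_set (pP i j)).
have [v [g [g_incr gE]]] : exists (v : {ffun 'I_m -> 'I_k}) (g : 'I_t -> 'I_n),
    {homo g : i j / (i < j)%N >-> (i < j)%N} /\
    forall j, [ffun i => lambda (q (widen_ord le_mn i) (g j))] = v.
  apply: (increasing_pigeonhole (fun j => [ffun i => lambda (q _ j)])).
  by rewrite card_ffun !card_ord -[ltnLHS]add0n ltn_add2r.
have [|c [h [h_incr hE]]] := @increasing_pigeonhole _ m t v.
  by rewrite card_ord.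
exists c, (fun i j => p (widen_ord le_mn (h i)) (g j)); split.
  move=> i i' j j'.
  have [px py] := p_grid (widen_ord le_mn (h i)) (widen_ord le_mn (h i')) (g j) (g j').
  by split=> [/h_incr /px | /g_incr /py].
(* The colour of this point is entry [h i] of the vector of row [g j]; that vector is [v], and
   [v (h i) = c]. *)
by move=> i j; exists (q (widen_ord le_mn (h i)) (g j)); rewrite //= -(hE i) -(gE j) ffunE.
Qed.
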